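(* Let $v\in[0,1]$, $x>0$, and $r=\min\{v,1-v\}$. Then $$\frac{(1-v)+vx}{x^v}\;\geq\; S(x)^r,$$ where $S$ denotes Specht's ratio.
   Context: Specht's ratio is the function $S:(0,\infty)\to(0,\infty)$ defined by $$S(x)=\frac{x^{\frac{1}{x-1}}}{e\,\log\left(x^{\frac{1}{x-1}}\right)}\quad (x>0,\ x\neq 1),\qquad S(1)=1,$$ where $\log$ is the natural logarithm (the value $S(1)=1$ is the limit of $S(x)$ as $x\to 1$). *)

(* Defs.v *)
From Stdlib Require Import Reals.
Local Open Scope R_scope.

(* Meaningful only for x > 0, where Rpower is the real power; the value is then
   positive, so it may itself serve as a base of Rpower. *)
Definition specht_ratio (x : R) : R :=
  if Req_dec_T x 1 then 1
  else Rpower x (1 / (x - 1)) / (exp 1 * ln (Rpower x (1 / (x - 1)))).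

(* Main.v *)
(* Write [G] for [(1 + x) / 2]. After taking logarithms, [ln (1 - v + v x)] is
   concave in [v] while the other terms are affine on each of [0, 1/2] and
   [1/2, 1], so the inequality reduces to the endpoints [v = 0, 1], where it is
   an equality, and to [v = 1/2], where it reads [ln S(x) <= 2 ln G - ln x].
   With [m = ln x / (x - 1)] one has [ln S(x) = m - 1 - ln m], and the midpoint
   case is the sum of [- ln m <= ln G] (logarithmic mean at most arithmetic mean)
   and [x m - 1 <= ln G] (identric mean at most arithmetic mean). *)
Require Import Defs.
From Stdlib Require Import Reals Lra.
From Coquelicot Require Import Coquelicot.
Local Open Scope R_scope.

Lemma ln_le_sub_1 (y : R) : 0 < y -> ln y <= y - 1.
Proof.
  intros hy.
  assert (h := exp_ineq1_le (ln y)).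
  rewrite exp_ln in h by exact hy. lra.
Qed.

(** The tangent to [ln] at the weighted mean [c] bounds [ln a] and [ln b] from above; in the
    weighted sum of the two bounds the linear terms cancel, leaving [ln c]. *)
Lemma ln_concave (a b t : R) : 0 < a -> 0 < b -> 0 <= t <= 1 ->
  (1 - t) * ln a + t * ln b <= ln ((1 - t) * a + t * b).
Proof.
  intros ha hb ht.
  set (c := (1 - t) * a + t * b).
  assert (hc : 0 < c) by (unfold c; destruct (Rle_dec t (1 / 2)); nra).
  assert (Ha := ln_le_sub_1 (a / c) (Rdiv_lt_0_compat _ _ ha hc)).
  assert (Hb := ln_le_sub_1 (b / c) (Rdiv_lt_0_compat _ _ hb hc)).
  rewrite ln_div in Ha, Hb by assumption.
  assert (He : (1 - t) * (a / c - 1) + t * (b / c - 1) = 0).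
  { replace ((1 - t) * (a / c - 1) + t * (b / c - 1)) with (c / c - 1).
    - field; lra.
    - unfold c at 1; field; lra. }
  nra.
Qed.

(** Using the quotient instead of a sign of [f x - f 1] lets [x < 1] and [x > 1] be treated together
    later. *)
Lemma slope_from_1_nonneg (f f' : R -> R) (x : R) :
  (forall y, 0 < y -> is_derive f y (f' y)) ->
  (forall y, 0 < y -> 0 <= f' y) ->
  0 < x -> x <> 1 -> 0 <= (f x - f 1) / (x - 1).
Proof.
  intros hd hp hx hne.
  destruct (Rdichotomy _ _ hne) as [hlt | hgt].
  - destruct (MVT_cor2 f f' x 1 hlt) as [c [hc hcx]].
    { intros y hy. apply is_derive_Reals, hd. lra. }
    replace ((f x - f 1) / (x - 1)) with (f' c).
    + apply hp. lra.
    + replace (f x - f 1) with (f' c * (x - 1)) by lra. field. lra.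
  - destruct (MVT_cor2 f f' 1 x hgt) as [c [hc hcx]].
    { intros y hy. apply is_derive_Reals, hd. lra. }
    rewrite hc.
    replace (f' c * (x - 1) / (x - 1)) with (f' c) by (field; lra).
    apply hp. lra.
Qed.

Lemma log_mean_le_arith (x : R) : 0 < x -> x <> 1 ->
  2 <= (x + 1) * (ln x / (x - 1)).
Proof.
  intros hx hne.
  (* The inequality multiplied by [x - 1]; the function vanishes at 1, and its derivative is
     nonnegative by [ln (/ y) <= / y - 1]. *)
  assert (h := slope_from_1_nonneg (fun y => (y + 1) * ln y - 2 * (y - 1))
                 (fun y => ln y + / y - 1) x).
  cbv beta in h. rewrite ln_1 in h.
  replace ((x + 1) * (ln x / (x - 1)))
    with (((x + 1) * ln x - 2 * (x - 1) - ((1 + 1) * 0 - 2 * (1 - 1))) / (x - 1) + 2)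
    by (field; lra).
  enough (0 <= ((x + 1) * ln x - 2 * (x - 1) - ((1 + 1) * 0 - 2 * (1 - 1))) / (x - 1))
    by lra.
  apply h; try assumption.
  - intros y hy. auto_derive; [lra | field; lra].
  - intros y hy.
    assert (hl := ln_le_sub_1 (/ y) (Rinv_0_lt_compat _ hy)).
    rewrite ln_Rinv in hl by exact hy. lra.
Qed.

(** The left side is the logarithm of the identric mean of 1 and [x]. After clearing [x - 1], the
    derivative is nonnegative by [ln z <= z - 1] at [z = y / ((1 + y) / 2)]. *)
Lemma ln_identric_le_arith (x : R) : 0 < x -> x <> 1 ->
  x * (ln x / (x - 1)) - 1 <= ln ((1 + x) / 2).
Proof.
  intros hx hne.
  assert (h := slope_from_1_nonneg
                 (fun y => (y - 1) * (ln ((1 + y) / 2) + 1) - y * ln y)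
                 (fun y => ln ((1 + y) / 2) + (y - 1) / (y + 1) - ln y) x).
  cbv beta in h. rewrite ln_1 in h.
  enough (0 <= ln ((1 + x) / 2) + 1 - x * (ln x / (x - 1))) by lra.
  replace (ln ((1 + x) / 2) + 1 - x * (ln x / (x - 1)))
    with (((x - 1) * (ln ((1 + x) / 2) + 1) - x * ln x
           - ((1 - 1) * (ln ((1 + 1) / 2) + 1) - 1 * 0)) / (x - 1))
    by (field; lra).
  apply h; try assumption.
  - intros y hy. auto_derive; [lra |].
    unfold Rdiv; field; lra.
  - intros y hy.
    assert (hg : 0 < (1 + y) / 2) by lra.
    assert (hl := ln_le_sub_1 (y / ((1 + y) / 2)) (Rdiv_lt_0_compat _ _ hy hg)).
    rewrite ln_div in hl by assumption.
    replace (y / ((1 + y) / 2) - 1) with ((y - 1) / (y + 1)) in hl by (field; lra).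
    lra.
Qed.

Lemma ln_specht_ratio_le (x : R) : 0 < x ->
  ln (specht_ratio x) <= 2 * ln ((1 + x) / 2) - ln x.
Proof.
  intros hx. unfold specht_ratio.
  destruct (Req_dec_T x 1) as [-> | hne].
  { replace ((1 + 1) / 2) with 1 by field. rewrite ln_1. lra. }
  assert (hL := log_mean_le_arith x hx hne).
  assert (hI := ln_identric_le_arith x hx hne).
  set (m := ln x / (x - 1)) in *.
  assert (hm : 0 < m) by nra.
  assert (hp : ln (Rpower x (1 / (x - 1))) = m).
  { unfold Rpower. rewrite ln_exp. unfold m. field. lra. }
  rewrite hp, ln_div, hp, ln_mult, ln_exp; try assumption.
  2: apply exp_pos.
  2: apply exp_pos.
  2: apply Rmult_lt_0_compat; [apply exp_pos | exact hm].
  assert (hG : 0 <= ln ((1 + x) / 2 * m)).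
  { rewrite <- ln_1. apply ln_le; lra. }
  rewrite ln_mult in hG by lra.
  (* Turns [m - 1 - ln m] into [(x * m - 1) - ln m - ln x], where both mean inequalities apply. *)
  assert (ln x = m * (x - 1)) by (unfold m; field; lra).
  lra.
Qed.

Theorem theorem2p1 (v x r : R) (hv : 0 <= v <= 1) (hx : 0 < x)
  (hr : r = Rmin v (1 - v)) :
  ((1 - v) + v * x) / Rpower x v >= Rpower (specht_ratio x) r.
Proof.
  assert (hS := ln_specht_ratio_le x hx).
  assert (hA : 0 < (1 - v) + v * x) by (destruct (Rle_dec v (1 / 2)); nra).
  apply Rle_ge.
  rewrite <- (exp_ln ((1 - v) + v * x)) by exact hA.
  unfold Rpower, Rdiv. rewrite <- exp_Ropp, <- exp_plus.
  apply Rnot_lt_le; intros hlt; apply exp_lt_inv in hlt.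
  revert hlt; apply Rle_not_lt.
  destruct (Rle_dec v (1 / 2)) as [hle | hgt].
  - rewrite hr, Rmin_left by lra.
    (* The chord from 0 to 1/2 leaves [v * (2 * ln ((1 + x) / 2) - ln x)], which [hS] bounds
       below. *)
    assert (hc := ln_concave 1 ((1 + x) / 2) (2 * v)).
    replace ((1 - 2 * v) * 1 + 2 * v * ((1 + x) / 2))
      with ((1 - v) + v * x) in hc by field.
    rewrite ln_1 in hc.
    assert (hc' := hc ltac:(lra) ltac:(lra) ltac:(lra)). nra.
  - rewrite hr, Rmin_right by lra.
    (* On the chord from 1/2 to 1 the same bracket appears with factor [1 - v]. *)
    assert (hc := ln_concave x ((1 + x) / 2) (2 * (1 - v))).
    replace ((1 - 2 * (1 - v)) * x + 2 * (1 - v) * ((1 + x) / 2))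
      with ((1 - v) + v * x) in hc by field.
    assert (hc' := hc ltac:(lra) ltac:(lra) ltac:(lra)). nra.
Qed.
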